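(* Let $\mathbb{F}$ be an algebraically closed field of characteristic zero and $G$ a finite group. Let $\theta$ be a $G$-commutation function (with values in $\mathbb{F}^\times$) such that $\theta_{g,g}=1$ for all $g\in G$. Then there is a 2-cocycle $\alpha\in Z^2(G,\mathbb{F}^\times)$ such that the commutation function of the twisted group algebra $B=\mathbb{F}^\alpha G$ is $\theta$.
   Context: For $\bar g=(g_1,\dots,g_n)\in G^n$, let $Sym(\bar g)=\{\sigma\in Sym(n): g_1\cdots g_n=g_{\sigma(1)}\cdots g_{\sigma(n)}\}$ and $\bar g^\sigma=(g_{\sigma(1)},\dots,g_{\sigma(n)})$. A $G$-commutation function is a function $\theta$ assigning to each pair $(\bar g,\sigma)$, $\bar g\in G^n$ ($n\ge1$), $\sigma\in Sym(\bar g)$, a scalar $\theta_{(\bar g,\sigma)}\in\mathbb{F}^\times$ such that: (1) if $1\le i\le j\le n$ and $\sigma\in Sym(\bar g)$ fixes all $k<i$ and all $k>j$, and $\tilde\sigma\in Sym(j-i+1)$ is the restriction of $\sigma$ to $\{i,\dots,j\}$ (reindexed), then $\theta_{(\bar g,\sigma)}=\theta_{((g_i,\dots,g_j),\tilde\sigma)}$; (2) if $\bar h=(h_1,\dots,h_k)\in G^k$, $\bar g_i=(g_{i,1},\dots,g_{i,n_i})\in G^{n_i}$ with $\prod_j g_{i,j}=h_i$, $\bar g=(\bar g_1,\dots,\bar g_k)$ is the concatenation, $\sigma\in Sym(\bar h)$, and $\tilde\sigma\in Sym(n_1+\cdots+n_k)$ is the permutation moving the blocks according to $\sigma$ (so $\bar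 g^{\tilde\sigma}=(\bar g_{\sigma(1)},\dots,\bar g_{\sigma(k)})$), then $\theta_{(\bar h,\sigma)}=\theta_{(\bar g,\tilde\sigma)}$; (3) if $\sigma,\tau\in Sym(n)$ with $g_1\cdots g_n=g_{\sigma(1)}\cdots g_{\sigma(n)}=g_{\sigma\tau(1)}\cdots g_{\sigma\tau(n)}$, then $\theta_{(\bar g,\sigma)}\theta_{(\bar g^\sigma,\tau)}=\theta_{(\bar g,\sigma\tau)}$. For commuting $g,h$, $\theta_{g,h}:=\theta_{((g,h),(1\,2))}$. The twisted group algebra $\mathbb{F}^\alpha G$ has basis $\{U_g\}_{g\in G}$ and product $U_gU_h=\alpha(g,h)U_{gh}$, graded by $(\mathbb{F}^\alpha G)_g=\mathbb{F}U_g$. Its commutation function is the one defined by $U_{g_1}\cdots U_{g_n}=\theta_{(\bar g,\sigma)}U_{g_{\sigma(1)}}\cdots U_{g_{\sigma(n)}}$ for $\sigma\in Sym(\bar g)$. *)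

(* Defs.v *)
(* MathComp *)
From HB Require Import structures.
From mathcomp Require Import all_boot all_order all_algebra all_fingroup.

Set Implicit Arguments.
Unset Strict Implicit.
Unset Printing Implicit Defensive.

Import GRing.Theory.

Local Open Scope ring_scope.

Section Tuples.
Variable G : finGroupType.

Definition tuple_prod n (g : n.-tuple G) : G := (\prod_(i < n) tnth g i)%g.

Definition tuple_act n (g : n.-tuple G) (s : 'S_n) : n.-tuple G :=
  [tuple tnth g (s i) | i < n].

Definition Sym_of n (g : n.-tuple G) : {set 'S_n} :=
  [set s | tuple_prod g == tuple_prod (tuple_act g s)].

Definition tuple_flatten k (n_ : 'I_k -> nat)
    (gs : forall i, (n_ i).-tuple G) : (\sum_i n_ i)%N.-tuple G :=
  [tuple tnth (gs (tagnat.sig1 x)) (tagnat.sig2 x) | x < (\sum_i n_ i)%N].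

End Tuples.

(* The position i + k of the segment {i, ..., j}.  No hypothesis i <= j is
   needed for the bound: if j < i then k = 0. *)
Lemma seg_ord_proof n (i j : 'I_n) (k : 'I_(j - i).+1) : (i + k < n)%N.
Proof.
have [le_ij | lt_ji] := leqP i j.
  have := leq_add (leqnn i) (ltn_ord k).
  by rewrite !addnS subnKC // => /leq_trans; apply.
have := ltn_ord k; move: (nat_of_ord k) => m.
rewrite (eqP (_ : j - i == 0)%N) ?subn_eq0 ?(ltnW lt_ji) //.
by rewrite ltnS leqn0 => /eqP ->; rewrite addn0.
Qed.

Definition seg_ord n (i j : 'I_n) (k : 'I_(j - i).+1) : 'I_n :=
  Ordinal (seg_ord_proof k).

Section BlockPerm.
Variables (k : nat) (n_ : 'I_k -> nat) (s : 'S_k).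

Lemma sum_block_perm : (\sum_i n_ (s i) = \sum_i n_ i)%N.
Proof. by rewrite [RHS](reindex_inj (@perm_inj _ s)). Qed.

(* After moving, the blocks have sizes n_ (s 0), n_ (s 1), ...; position
   (i, j) of that decomposition is sent to position (s i, j) of the original
   one. *)
Definition block_perm_fun (x : 'I_(\sum_i n_ i)) : 'I_(\sum_i n_ i) :=
  let y := cast_ord (esym sum_block_perm) x in
  tagnat.Rank (s (tagnat.sig1 y)) (tagnat.sig2 y).

Lemma block_perm_inj : injective block_perm_fun.
Proof.
move=> x1 x2 /tagnat.rank_inj eq12.
apply: (@cast_ord_inj _ _ (esym sum_block_perm)); move: eq12.
move: (cast_ord _ x1) (cast_ord _ x2) => y1 y2.
move=> eq12; rewrite -(tagnat.sig2K y1) -(tagnat.sig2K y2); move: eq12.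
move: (tagnat.sig1 y1) (tagnat.sig2 y1) (tagnat.sig1 y2) (tagnat.sig2 y2).
move=> i1 j1 i2 j2 eq12.
have /perm_inj eq_i : s i1 = s i2 by have := congr1 tag eq12.
subst i2; congr tagnat.Rank.
by apply/eqP; move/eqP: eq12; rewrite eq_Tagged.
Qed.

Definition block_perm : 'S_(\sum_i n_ i) := perm block_perm_inj.

End BlockPerm.

(* theta n g s is only meaningful for 0 < n and s \in Sym_of g; its other
   values are irrelevant, and no condition bears on them. *)
Record is_commutation_fun (F : fieldType) (G : finGroupType)
    (theta : forall n, n.-tuple G -> 'S_n -> F) : Prop := CommutationFun {
  commfun_neq0 : forall n (g : n.-tuple G) (s : 'S_n),
    (0 < n)%N -> s \in Sym_of g -> theta n g s != 0;
  commfun_segment : forall n (g : n.-tuple G) (s : 'S_n) (i j : 'I_n)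
      (t : 'S_(j - i).+1),
    (i <= j)%N -> s \in Sym_of g ->
    (forall k : 'I_n, (k < i)%N || (j < k)%N -> s k = k) ->
    (forall k, s (seg_ord k) = seg_ord (t k)) ->
    theta n g s = theta (j - i).+1 [tuple tnth g (seg_ord k) | k < (j - i).+1] t;
  commfun_block : forall k (h : k.-tuple G) (s : 'S_k) (n_ : 'I_k -> nat)
      (gs : forall i, (n_ i).-tuple G),
    (0 < k)%N -> (forall i, (0 < n_ i)%N) ->
    (forall i, tuple_prod (gs i) = tnth h i) ->
    s \in Sym_of h ->
    theta k h s = theta (\sum_i n_ i)%N (tuple_flatten gs) (block_perm n_ s);
  (* The product of permutations in MathComp is (t * s) i = s (t i), so the
     composite i |-> s (t i) is t * s. *)
  commfun_comp : forall n (g : n.-tuple G) (s t : 'S_n),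
    (0 < n)%N -> s \in Sym_of g -> (t * s)%g \in Sym_of g ->
    theta n g s * theta n (tuple_act g s) t = theta n g (t * s)%g
}.

Definition commfun2 (F : fieldType) (G : finGroupType)
    (theta : forall n, n.-tuple G -> 'S_n -> F) (g h : G) : F :=
  theta 2 [tuple g; h] (tperm ord0 ord_max).

Record cocycle2 (F : fieldType) (G : finGroupType) := Cocycle2 {
  cocycle2_fun :> G -> G -> F;
  cocycle2_neq0 : forall g h, cocycle2_fun g h != 0;
  cocycle2P : forall g h k,
    cocycle2_fun g h * cocycle2_fun (g * h)%g k =
    cocycle2_fun h k * cocycle2_fun g (h * k)%g
}.

Definition twisted_group_algebra (F : fieldType) (G : finGroupType)
  (alpha : cocycle2 F G) : Type := {ffun G -> F^o}.

Section TwistedGroupAlgebra.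
Variables (F : fieldType) (G : finGroupType) (alpha : cocycle2 F G).

Local Notation A := (twisted_group_algebra alpha).

HB.instance Definition _ := GRing.Lmodule.copy A {ffun G -> F^o}.

Definition tga_basis (g : G) : A := [ffun h => (h == g)%:R].

Local Notation U := tga_basis.

Definition tga_mul (x y : A) : A :=
  \sum_g \sum_h (x g * y h * alpha g h) *: U (g * h)%g.

Definition tga_one : A := (alpha 1%g 1%g)^-1 *: U 1%g.

Lemma tga_basisE (x : A) : x = \sum_g x g *: U g.
Proof.
apply/ffunP => h; rewrite sum_ffunE (bigD1 h) //= !ffunE eqxx.
rewrite big1 ?addr0 => [|g ne_gh]; first by rewrite [_ *: _]mulr1.
by rewrite !ffunE eq_sym (negPf ne_gh) [_ *: _]mulr0.
Qed.

Lemma tga_addE (x y : A) g : (x + y) g = x g + y g.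
Proof. by rewrite ffunE. Qed.

Lemma tga_scaleE a (x : A) g : (a *: x) g = a * x g.
Proof. by rewrite ffunE. Qed.

Lemma tga_mulDl : left_distributive tga_mul +%R.
Proof.
move=> x y z; rewrite -big_split; apply: eq_bigr => g _.
rewrite -big_split; apply: eq_bigr => h _ /=.
by rewrite tga_addE !mulrDl scalerDl.
Qed.

Lemma tga_mulDr : right_distributive tga_mul +%R.
Proof.
move=> x y z; rewrite -big_split; apply: eq_bigr => g _.
rewrite -big_split; apply: eq_bigr => h _ /=.
by rewrite tga_addE mulrDr mulrDl scalerDl.
Qed.

Lemma tga_scalerAl a x y : a *: tga_mul x y = tga_mul (a *: x) y.
Proof.
rewrite /tga_mul scaler_sumr; apply: eq_bigr => g _.
rewrite scaler_sumr; apply: eq_bigr => h _.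
by rewrite tga_scaleE scalerA !mulrA.
Qed.

Lemma tga_scalerAr a x y : a *: tga_mul x y = tga_mul x (a *: y).
Proof.
rewrite /tga_mul scaler_sumr; apply: eq_bigr => g _.
rewrite scaler_sumr; apply: eq_bigr => h _.
by rewrite tga_scaleE scalerA !mulrA [a * _]mulrC.
Qed.

Lemma tga_mul0l x : tga_mul 0 x = 0.
Proof. by have := tga_scalerAl 0 0 x; rewrite !scale0r. Qed.

Lemma tga_mul0r x : tga_mul x 0 = 0.
Proof. by have := tga_scalerAr 0 x 0; rewrite !scale0r. Qed.

Lemma tga_mul_suml (f : G -> A) y :
  tga_mul (\sum_g f g) y = \sum_g tga_mul (f g) y.
Proof.
exact: (big_morph (tga_mul^~ y) (fun u v => tga_mulDl u v y) (tga_mul0l y)).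
Qed.

Lemma tga_mul_sumr x (f : G -> A) :
  tga_mul x (\sum_g f g) = \sum_g tga_mul x (f g).
Proof.
exact: (big_morph (tga_mul x) (tga_mulDr x) (tga_mul0r x)).
Qed.

Lemma tga_mulUU g h : tga_mul (U g) (U h) = alpha g h *: U (g * h)%g.
Proof.
rewrite /tga_mul (bigD1 g) //= (bigD1 h) //= !ffunE !eqxx !mul1r.
rewrite !big1 ?addr0 // => [g' neg | h' neh].
  by apply: big1 => h' _; rewrite !ffunE (negPf neg) !mul0r scale0r.
by rewrite !ffunE (negPf neh) mulr0 mul0r scale0r.
Qed.

Lemma tga_mulA : associative tga_mul.
Proof.
move=> x y z; rewrite (tga_basisE x).
rewrite (tga_mul_suml _ (tga_mul y z)) (tga_mul_suml _ y) (tga_mul_suml _ z).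
apply: eq_bigr => g _; rewrite -!tga_scalerAl; congr (_ *: _).
rewrite (tga_basisE y) (tga_mul_suml _ z) 2!(tga_mul_sumr (U g)).
rewrite (tga_mul_suml _ z); apply: eq_bigr => h _.
rewrite -tga_scalerAl -!(tga_scalerAr _ (U g)) -tga_scalerAl; congr (_ *: _).
rewrite (tga_basisE z) (tga_mul_sumr (U h)) (tga_mul_sumr (U g)).
rewrite (tga_mul_sumr (tga_mul (U g) (U h))); apply: eq_bigr => k _.
rewrite -!tga_scalerAr; congr (_ *: _).
rewrite !tga_mulUU -tga_scalerAl -tga_scalerAr !tga_mulUU !scalerA.
by rewrite [alpha h k * _]mulrC mulrC -cocycle2P mulgA.
Qed.

Lemma cocycle2_1l g : alpha 1%g g = alpha 1%g 1%g.
Proof.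
apply: (mulIf (cocycle2_neq0 alpha 1%g g)).
by have := cocycle2P alpha 1%g 1%g g; rewrite !mul1g => ->.
Qed.

Lemma cocycle2_1r g : alpha g 1%g = alpha 1%g 1%g.
Proof.
apply: (mulIf (cocycle2_neq0 alpha g 1%g)).
by have := cocycle2P alpha g 1%g 1%g; rewrite !mulg1 => ->.
Qed.

Lemma tga_mul1l : left_id tga_one tga_mul.
Proof.
move=> x; rewrite {1}(tga_basisE x) tga_mul_sumr {2}(tga_basisE x).
apply: eq_bigr => g _; rewrite -tga_scalerAr -tga_scalerAl tga_mulUU.
by rewrite !scalerA cocycle2_1l -mulrA mulVf ?cocycle2_neq0 // mulr1 mul1g.
Qed.

Lemma tga_mul1r : right_id tga_one tga_mul.
Proof.
move=> x; rewrite {1}(tga_basisE x) tga_mul_suml {2}(tga_basisE x).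
apply: eq_bigr => g _; rewrite -tga_scalerAr -tga_scalerAl tga_mulUU.
by rewrite !scalerA cocycle2_1r mulrAC mulVf ?cocycle2_neq0 // mul1r mulg1.
Qed.

Lemma tga_one_neq0 : tga_one != 0.
Proof.
apply/eqP => /ffunP/(_ 1%g) /eqP; rewrite !ffunE eqxx.
by rewrite [_ *: _]mulr1; apply/negP; rewrite invr_eq0 cocycle2_neq0.
Qed.

HB.instance Definition _ := GRing.Zmodule_isNzRing.Build A
  tga_mulA tga_mul1l tga_mul1r tga_mulDl tga_mulDr tga_one_neq0.
HB.instance Definition _ := GRing.Lmodule_isLalgebra.Build F A tga_scalerAl.
HB.instance Definition _ := GRing.Lalgebra_isAlgebra.Build F A tga_scalerAr.

Definition is_tga_commutation_fun
    (theta : forall n, n.-tuple G -> 'S_n -> F) : Prop :=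
  forall n (g : n.-tuple G) (s : 'S_n), (0 < n)%N -> s \in Sym_of g ->
    \prod_(i < n) U (tnth g i) =
    theta n g s *: \prod_(i < n) U (tnth g (s i)).

End TwistedGroupAlgebra.

(* Main.v *)
Require Import Defs.
From mathcomp Require Import all_boot all_order all_algebra all_fingroup.
From mathcomp Require Import cyclic zify ring.

(** Write a rearrangement of a word over G as a pair of words u, v with the
    same letters and the same product.  In any twisted group algebra with
    commutation function theta, the products of the U's along u and v differ
    by the factor that theta assigns to any permutation taking u to v; so a
    cocycle is a way of writing each of these factors as a quotient
    D(u) / D(v), with D compatible with concatenation.

    The factor has to depend on u and v only, that is, theta has to be 1 on
    permutations that fix a word.  Those are products of transpositions of
    equal letters.  If a word contains a letter a at two places, cut it after
    the second one and append one more a: the transposition of the two places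
    is then conjugate, inside the stabiliser of the new word, to the
    transposition of the two adjacent a's at its end, on which theta takes
    the value theta_{a,a} = 1 (theta_tperm, theta_stab).  The resulting function Th on pairs of words is
    multiplicative along chains of rearrangements, does not see a common
    context, and is 1 when a subword of product 1 is moved elsewhere, because
    theta_{1,h} is idempotent (word_theta_commutation).

    Hence words of product 1 are central for Th, and modulo Th they form a
    commutative monoid that is an extension, by the scalars, of a monoid of
    multisets of letters.  The heart of the proof is that this extension
    splits: there is a multiplicative c on words of product 1 with
    c(u) = Th(u,v) c(v) (exists_char).  On words in which every letter has
    multiplicity divisible by |G| one may take for c the factor that sorts
    the word, since blocks of |G| equal letters have product 1.  Given c on a
    submonoid S stable under quotients and a further word w of product 1,
    some power of w lies in S; over an algebraically closed field a suitable
    root of the value of c there serves as c(w), and c extends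
    (adjoin_char).  Adjoining the finitely many words (gh)^-1 g h and g^-1 g
    reaches all words of product 1 (adm_generated).

    Finally D(w) := c(p^-1 w) / c(p^-1 p), with p the product of w, satisfies
    D(uv) = D(u) D(v) D([g; h]) for u of product g and v of product h
    (word_coef_cat).  So alpha(g,h) := D([g; h]) is a cocycle, and the product
    of the U's along w is D(w) U_p. *)

Set Implicit Arguments.
Unset Strict Implicit.
Unset Printing Implicit Defensive.

Import GRing.Theory.

Local Open Scope ring_scope.

(** * Words and their rearrangements *)

Section Words.
Variable G : finGroupType.
Implicit Types (u v w x y : seq G) (g h : G).

Definition word_prod w : G := (\prod_(x <- w) x)%g.

Lemma word_prod_cat u v : word_prod (u ++ v) = (word_prod u * word_prod v)%g.
Proof. exact: big_cat. Qed.

Lemma word_prod_cons g w : word_prod (g :: w) = (g * word_prod w)%g.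
Proof. exact: big_cons. Qed.

Lemma word_prod_nil : word_prod [::] = 1%g.
Proof. exact: big_nil. Qed.

Definition word_prodE := (word_prod_cat, word_prod_cons, word_prod_nil).

Definition trivial_word w := word_prod w == 1%g.

Definition rearranged u v := perm_eq u v && (word_prod u == word_prod v).

Lemma rearranged_refl u : rearranged u u.
Proof. by rewrite /rearranged perm_refl eqxx. Qed.

Lemma rearranged_context x y u v : rearranged u v ->
  rearranged (x ++ u ++ y) (x ++ v ++ y).
Proof.
case/andP=> uv /eqP puv; rewrite /rearranged perm_cat2l perm_cat2r uv.
by rewrite !word_prodE puv eqxx.
Qed.

Lemma rearranged_trans v u w :
  rearranged u v -> rearranged v w -> rearranged u w.
Proof.
case/andP=> r1 /eqP p1 /andP[r2 p2].
by rewrite /rearranged p1 p2 (perm_trans r1 r2).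
Qed.

Lemma rearranged_swap u v : trivial_word u -> rearranged (u ++ v) (v ++ u).
Proof.
move=> /eqP pu; rewrite /rearranged perm_catC perm_refl !word_prodE pu.
by rewrite mul1g mulg1 eqxx.
Qed.

Lemma rearranged_swap_context x u v y : trivial_word u ->
  rearranged (x ++ u ++ v ++ y) (x ++ v ++ u ++ y).
Proof.
move=> u1; rewrite (catA u) (catA v).
exact/rearranged_context/rearranged_swap.
Qed.

Lemma trivial_word_cat u v :
  trivial_word u -> trivial_word v -> trivial_word (u ++ v).
Proof. by rewrite /trivial_word word_prodE => /eqP-> /eqP->; rewrite mulg1. Qed.

Lemma rearranged_trivial u v :
  rearranged u v -> trivial_word u -> trivial_word v.
Proof. by rewrite /trivial_word => /andP[_ /eqP->]. Qed.

Definition word_pow w n := flatten (nseq n w).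

Lemma word_powD w m n : word_pow w (m + n) = word_pow w m ++ word_pow w n.
Proof. by rewrite /word_pow nseqD flatten_cat. Qed.

Lemma word_powS w n : word_pow w n.+1 = w ++ word_pow w n.
Proof. by []. Qed.

Lemma trivial_word_pow w n : trivial_word w -> trivial_word (word_pow w n).
Proof.
move=> w1; elim: n => [|n IHn]; first by rewrite /trivial_word word_prodE.
exact: trivial_word_cat.
Qed.

Lemma count_word_pow a w n : count a (word_pow w n) = (n * count a w)%N.
Proof. by rewrite count_flatten map_nseq sumn_nseq mulnC. Qed.

End Words.

(** The properties of the commutation factors of words that the construction
    of a cocycle relies on.  The last one says that words of product 1 are
    central. *)
Record is_word_commutation (F : fieldType) (G : finGroupType)
    (Th : seq G -> seq G -> F) : Prop := WordCommutation {
  wordcomm_neq0 : forall u v, rearranged u v -> Th u v != 0;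
  wordcomm_trans : forall u v w, rearranged u v -> rearranged v w ->
    Th u v * Th v w = Th u w;
  wordcomm_context : forall x y u v, rearranged u v ->
    Th (x ++ u ++ y) (x ++ v ++ y) = Th u v;
  wordcomm_swap : forall u v, trivial_word u -> Th (u ++ v) (v ++ u) = 1
}.

(** * The commutation factor of a pair of words *)

Section CommFun.
Variables (F : fieldType) (G : finGroupType).
Variable theta : forall n, n.-tuple G -> 'S_n -> F.
Hypothesis theta_comm : is_commutation_fun theta.
Hypothesis theta_diag : forall g : G, commfun2 theta g g = 1.

Lemma tuple_prodE n (g : n.-tuple G) : tuple_prod g = word_prod g.
Proof. by rewrite /word_prod /tuple_prod big_tuple. Qed.

Lemma tuple_actM n (g : n.-tuple G) (s t : 'S_n) :
  tuple_act (tuple_act g s) t = tuple_act g (t * s)%g.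
Proof. by apply: eq_from_tnth => i; rewrite !tnth_mktuple permM. Qed.

Lemma tuple_act1 n (g : n.-tuple G) : tuple_act g 1%g = g.
Proof. by apply: eq_from_tnth => i; rewrite tnth_mktuple perm1. Qed.

Lemma stab_Sym n (g : n.-tuple G) s : tuple_act g s = g -> s \in Sym_of g.
Proof. by move=> gs; rewrite inE gs. Qed.

Lemma theta1 n (g : n.-tuple G) : (0 < n)%N -> theta g 1%g = 1.
Proof.
move=> n_gt0; have S1 : 1%g \in Sym_of g by rewrite stab_Sym ?tuple_act1.
apply: (mulfI (commfun_neq0 theta_comm n_gt0 S1)); rewrite mulr1.
have := commfun_comp theta_comm (t := 1%g) n_gt0 S1; rewrite mulg1 tuple_act1.
exact.
Qed.

Lemma theta_stabM n (g : n.-tuple G) s t : (0 < n)%N ->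
  tuple_act g s = g -> tuple_act g t = g ->
  theta g (t * s)%g = theta g s * theta g t.
Proof.
move=> n_gt0 gs gt; have := commfun_comp theta_comm (g := g) (s := s) (t := t).
rewrite gs => -> //; first exact: stab_Sym.
by apply: stab_Sym; rewrite -tuple_actM gs.
Qed.

(** The segment condition for tuples g' of any size and a segment given by its
    length, which avoids dependent types in later uses. *)
Lemma theta_segment m n (g : m.-tuple G) (g' : n.-tuple G) (s : 'S_m)
    (t : 'S_n) (x : nat) :
  (0 < n)%N -> (x + n <= m)%N ->
  (forall k, (k < n)%N -> nth 1%g g (x + k) = nth 1%g g' k) ->
  (forall k : 'I_m, (k < x)%N || (x + n <= k)%N -> s k = k) ->
  (forall (k : 'I_m) (l : 'I_n), k = (x + l)%N :> nat ->
     s k = (x + t l)%N :> nat) ->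
  s \in Sym_of g -> theta g s = theta g' t.
Proof.
case: n => // n in g' t * => _ le_m gg' s_out s_in sS.
have lt_xm : (x < m)%N by rewrite (leq_trans _ le_m) // addnS ltnS leq_addr.
have lt_nm : (x + n < m)%N by rewrite -addnS.
pose i := Ordinal lt_xm; pose j := Ordinal lt_nm.
have [ix jx] : i = x :> nat /\ j = (x + n)%N :> nat by [].
clearbody i j; rewrite addnS -jx -ix in s_out.
have le_ij : (i <= j)%N by rewrite ix jx leq_addr.
have e : (j - i).+1 = n.+1 by rewrite ix jx addKn.
rewrite -ix {jx le_m lt_xm lt_nm} in gg' s_in *.
case: _ / e g' t gg' s_in => g' t gg' s_in.
rewrite (@commfun_segment _ _ _ theta_comm _ g s i j t) //.
- congr theta; apply: eq_from_tnth => k; rewrite tnth_mktuple.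
  by rewrite !(tnth_nth 1%g) -gg'.
- by move=> k; apply: val_inj; exact: s_in.
Qed.

Lemma val_tperm n (i j k : 'I_n) :
  tperm i j k = (if k == i :> nat then j : nat else
                 if k == j :> nat then i : nat else k) :> nat.
Proof. by rewrite !val_eqE permE /=; case: eqP => // _; case: eqP. Qed.

Lemma tperm_stab n (g : n.-tuple G) (i j : 'I_n) :
  tnth g i = tnth g j -> tuple_act g (tperm i j) = g.
Proof.
move=> gij; apply: eq_from_tnth => k; rewrite tnth_mktuple.
by case: tpermP => [->|->|].
Qed.

Lemma theta_tperm_adjacent n (g : n.-tuple G) (i j : 'I_n) :
  j = i.+1 :> nat -> tnth g i = tnth g j -> theta g (tperm i j) = 1.
Proof.
move=> ji gij; rewrite -(theta_diag (tnth g i)).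
apply: (theta_segment (x := i)) => //.
- by rewrite addn2 -ji.
- move=> [|[|//]] _ /=; first by rewrite addn0 -tnth_nth.
  by rewrite addn1 -ji -tnth_nth.
- move=> k k_out; apply: val_inj; rewrite /= val_tperm ji.
  by case: eqP => [|_]; [lia | case: eqP; lia].
- move=> k l kl; rewrite !val_tperm kl ji.
  by case: l {kl} => [[|[|//]]] /= _; rewrite ?addn0 ?addn1 ?eqxx ?gtn_eqF.
- by apply: stab_Sym; apply: tperm_stab.
Qed.

(** Only for adjacent positions is this a restatement of theta_{a,a} = 1.  In
    general, truncate the word after the second occurrence j of the letter a
    and append another a at position l.  Then (i j) is the conjugate of (j l)
    by (i l), all three permutations fix the new word, theta is a morphism to
    a commutative group on its stabiliser, and j and l are adjacent. *)
Lemma theta_tperm n (g : n.-tuple G) (i j : 'I_n) :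
  tnth g i = tnth g j -> theta g (tperm i j) = 1.
Proof.
wlog lt_ij : i j / (i < j)%N => [IH|] gij.
  have [/IH|/IH H|/val_inj ->] := ltngtP i j; first exact.
  - by rewrite tpermC; apply: H.
  - by rewrite tperm1 theta1 //; case: (j) => ? /(leq_ltn_trans _) ->.
set a := tnth g i in gij.
pose g1 : j.+1.-tuple G := [tuple nth 1%g g k | k < j.+1].
pose g2 : j.+2.-tuple G :=
  [tuple if (k <= j)%N then nth 1%g g k else a | k < j.+2].
have lt_ij1 : (i < j.+1)%N by rewrite ltnS ltnW.
have lt_ij2 : (i < j.+2)%N by rewrite ltnW.
pose i2 := Ordinal lt_ij2; pose j2 : 'I_j.+2 := inord j.
pose l2 : 'I_j.+2 := ord_max.
have j2E : j2 = j :> nat by rewrite inordK.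
have gi2 : tnth g2 i2 = a by rewrite tnth_mktuple /= ltnW // -tnth_nth.
have gj2 : tnth g2 j2 = a by rewrite tnth_mktuple j2E leqnn -tnth_nth.
have gl2 : tnth g2 l2 = a by rewrite tnth_mktuple /= ltnn.
have -> : theta g (tperm i j) = theta g1 (tperm (Ordinal lt_ij1) ord_max).
  apply: (theta_segment (x := 0)); rewrite ?add0n ?ltn_ord //.
  - by move=> k lt_k; rewrite (nth_mktuple _ _ (Ordinal lt_k)).
  - move=> k /=  lt_jk; apply: val_inj; rewrite /= val_tperm.
    by rewrite !gtn_eqF // (ltn_trans lt_ij).
  - by move=> k l kl; rewrite !val_tperm kl.
  - by apply: stab_Sym; apply: tperm_stab.
have <- : theta g2 (tperm i2 j2) = theta g1 (tperm (Ordinal lt_ij1) ord_max).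
  apply: (theta_segment (x := 0)); rewrite ?add0n ?ltn_ord //.
  - move=> k lt_k; rewrite (nth_mktuple _ _ (Ordinal lt_k)).
    rewrite (nth_mktuple _ _ (Ordinal (ltnW lt_k : (k < j.+2)%N))) /=.
    by rewrite -ltnS lt_k.
  - move=> k /=  lt_jk; apply: val_inj; rewrite /= val_tperm.
    by rewrite j2E !gtn_eqF // (ltn_trans lt_ij).
  - by move=> k l kl; rewrite !val_tperm kl j2E.
  - by apply: stab_Sym; apply: tperm_stab; rewrite gi2.
have -> : tperm i2 j2 = (tperm i2 l2 * (tperm j2 l2 * tperm i2 l2))%g.
  rewrite -{1}(tpermV i2 l2) -[RHS]conjgE tpermJ tpermR tpermD 1?tpermC //.
    by rewrite -val_eqE /= j2E ltn_eqF.
  by rewrite -val_eqE /= j2E gtn_eqF.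
have stI := tperm_stab (etrans gi2 (esym gl2)).
have stJ := tperm_stab (etrans gj2 (esym gl2)).
rewrite !theta_stabM //; last by rewrite -tuple_actM stI.
rewrite mulrAC -theta_stabM // tperm2 theta1 // mul1r.
by apply: theta_tperm_adjacent; rewrite ?gj2 //= j2E.
Qed.

(** A permutation s that fixes the word and moves i is the product of the
    transposition of the equal letters at i and s i with a permutation that
    fixes the word and moves fewer positions. *)
Lemma theta_stab n (g : n.-tuple G) s : (0 < n)%N ->
  tuple_act g s = g -> theta g s = 1.
Proof.
move=> n_gt0; have [m] := ubnP #|[pred i | s i != i]|.
elim: m s => // m IHm s; rewrite ltnS => lem gs.
have [/forallP s1|] := boolP [forall i, s i == i].
  have -> : s = 1%g by apply/permP => i; rewrite perm1; apply/eqP.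
  exact: theta1.
rewrite negb_forall => /existsP[i si_neq].
pose t := tperm i (s i).
have gt : tuple_act g t = g.
  by apply: tperm_stab; rewrite -{1}gs tnth_mktuple.
have -> : s = (s * t * t)%g by rewrite -mulgA tperm2 mulg1.
have gst : tuple_act g (s * t)%g = g by rewrite -tuple_actM gt.
rewrite theta_stabM // theta_tperm ?mul1r; last by rewrite -{1}gs tnth_mktuple.
apply: IHm => //; apply: leq_trans lem; apply: proper_card.
apply/properP; split; last first.
  by exists i => //; rewrite !inE permM tpermR eqxx.
apply/subsetP => k; rewrite !inE permM; apply: contra => /eqP sk.
rewrite sk tpermD //; first by apply: contraNneq si_neq => ->; rewrite sk.
rewrite -[X in _ != X]sk (inj_eq perm_inj).
by apply: contraNneq si_neq => ->; rewrite sk.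
Qed.

Lemma theta_act_eq n (g : n.-tuple G) s t : (0 < n)%N -> s \in Sym_of g ->
  tuple_act g s = tuple_act g t -> theta g s = theta g t.
Proof.
move=> n_gt0 sS gst; have tS : t \in Sym_of g by move: sS; rewrite !inE gst.
have e : ((t * s^-1) * s = t)%g by rewrite mulgKV.
have := commfun_comp theta_comm (g := g) (s := s) (t := (t * s^-1)%g) n_gt0 sS.
rewrite e => /(_ tS) <-; rewrite (theta_stab (g := tuple_act g s)) ?mulr1 //.
by rewrite tuple_actM e -gst.
Qed.

(** The value theta takes on any permutation transforming u into v.  The case
    u = v is separate because theta carries no information on the empty
    tuple. *)
Definition word_theta (u v : seq G) : F :=
  if u == v then 1 else
  if [pick s : 'S_(size u) | tuple_act (in_tuple u) s == v :> seq G] is Some s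
  then theta (in_tuple u) s else 0.

Lemma word_thetaE n (g : n.-tuple G) s : (0 < n)%N -> s \in Sym_of g ->
  word_theta g (tuple_act g s) = theta g s.
Proof.
case: g => u sz; have ez := eqP sz; subst n.
rewrite [Tuple sz](_ : _ = in_tuple u); last exact: val_inj.
move=> n_gt0 sS; rewrite /word_theta; case: eqP => [e|_].
  by rewrite theta_stab //; apply: val_inj; exact: esym.
case: pickP => [t /eqP/val_inj e|/(_ s)]; last by rewrite eqxx.
by rewrite (theta_act_eq (t := s)) //; move: sS; rewrite !inE e.
Qed.

Lemma rearrangedP n (g : n.-tuple G) v : rearranged g v ->
  exists2 s, s \in Sym_of g & v = tuple_act g s.
Proof.
case/andP; rewrite perm_sym => /tuple_permP[s e] /eqP gv; exists s => //.
by rewrite inE !tuple_prodE gv e.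
Qed.

Lemma rearranged_tuple_act n (g : n.-tuple G) s :
  s \in Sym_of g -> rearranged g (tuple_act g s).
Proof.
rewrite inE !tuple_prodE /rearranged => ->; rewrite andbT perm_sym.
by apply/tuple_permP; exists s.
Qed.

Lemma word_theta_refl u : word_theta u u = 1.
Proof. by rewrite /word_theta eqxx. Qed.

Lemma rearranged_cases u v : rearranged u v -> u = v \/
  exists n (g : n.-tuple G) s,
    [/\ (0 < n)%N, s \in Sym_of g, u = g & v = tuple_act g s].
Proof.
move=> uv; have [e|nz] := posnP (size u); [left | right].
  case/andP: uv => /perm_size; rewrite e; case: (u) e => // _.
  by case: (v).
have [s sS ->] := rearrangedP (g := in_tuple u) uv.
by exists (size u), (in_tuple u), s.
Qed.

Lemma word_theta_neq0 u v : rearranged u v -> word_theta u v != 0.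
Proof.
case/rearranged_cases => [->|[n [g [s [n_gt0 sS -> ->]]]]].
  by rewrite word_theta_refl oner_neq0.
by rewrite word_thetaE // (commfun_neq0 theta_comm).
Qed.

Lemma word_theta_trans u v w : rearranged u v -> rearranged v w ->
  word_theta u v * word_theta v w = word_theta u w.
Proof.
case/rearranged_cases => [->|[n [g [s [n_gt0 sS -> ->]]]]].
  by rewrite word_theta_refl mul1r.
case/rearrangedP => t tS ->.
have tsS : (t * s)%g \in Sym_of g.
  by move: sS tS; rewrite !inE tuple_actM => /eqP->.
rewrite (word_thetaE n_gt0 sS) (word_thetaE n_gt0 tS) tuple_actM.
by rewrite word_thetaE // (commfun_comp theta_comm).
Qed.

(** The permutation s applied to the middle block of a word in three
    blocks. *)
Definition middle_fun a n b (s : 'S_n) (k : 'I_(a + (n + b))) :=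
  if split k is inr k' then
    if split k' is inl l then rshift a (lshift b (s l)) else k
  else k.

Lemma middle_funK a n b (s : 'S_n) :
  cancel (@middle_fun a n b s) (middle_fun s^-1).
Proof.
move=> k; rewrite /middle_fun; case: (split_ordP k) => [l ->|l ->].
  by rewrite (unsplitK (inl l)).
case: (split_ordP l) => [i ->|i ->].
  by rewrite (unsplitK (inr _)) (unsplitK (inl _)) permK.
by rewrite (unsplitK (inr _)) (unsplitK (inr _)).
Qed.

Definition middle_perm a n b (s : 'S_n) : 'S_(a + (n + b)) :=
  perm (can_inj (@middle_funK a n b s)).

Lemma tuple_act_middle a n b (x : a.-tuple G) (g : n.-tuple G)
    (y : b.-tuple G) s :
  tuple_act [tuple of x ++ g ++ y] (middle_perm a b s) =
  [tuple of x ++ tuple_act g s ++ y].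
Proof.
apply: eq_from_tnth => k; rewrite tnth_mktuple permE /middle_fun.
case: (split_ordP k) => [l ->|l ->]; first by rewrite !tnth_lshift.
rewrite tnth_rshift; case: (split_ordP l) => [i ->|i ->].
  by rewrite tnth_rshift !tnth_lshift tnth_mktuple.
by rewrite !tnth_rshift.
Qed.

Lemma word_theta_context x y u v : rearranged u v ->
  word_theta (x ++ u ++ y) (x ++ v ++ y) = word_theta u v.
Proof.
case/rearranged_cases => [->|[n [g [s [n_gt0 sS -> ->]]]]].
  by rewrite !word_theta_refl.
pose t := middle_perm (size x) (size y) s.
pose h := [tuple of in_tuple x ++ g ++ in_tuple y].
have e := tuple_act_middle (in_tuple x) g (in_tuple y) s.
have tS : t \in Sym_of h.
  move: sS; rewrite !inE e !tuple_prodE => /eqP gs.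
  by rewrite !word_prod_cat gs.
have h_gt0 : (0 < size x + (n + size y))%N by lia.
have := word_thetaE h_gt0 tS; rewrite e => ->; rewrite word_thetaE //.
apply: (theta_segment (x := size x)) => //.
- by rewrite addnA leq_addr.
- move=> k lt_k; rewrite nth_cat ltnNge leq_addr addKn nth_cat.
  by rewrite size_tuple lt_k.
- move=> k; rewrite permE /middle_fun.
  case: (split_ordP k) => [//|l ->].
  by case: (split_ordP l) => [i -> /=|//]; have := ltn_ord i; lia.
- move=> k l kl; rewrite permE /middle_fun.
  have -> : k = rshift (size x) (lshift (size y) l) by apply: val_inj.
  by rewrite (unsplitK (inr _)) (unsplitK (inl _)).
Qed.

Lemma tuple_flatten2 (w : 'I_2 -> seq G) :
  tuple_flatten (fun i => in_tuple (w i)) = w ord0 ++ w ord_max :> seq G.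
Proof.
apply: (@eq_from_nth _ 1%g) => [|k].
  rewrite size_tuple size_cat big_ord_recl big_ord1.
  by congr (_ + size (w _))%N; apply: val_inj.
rewrite size_tuple => lt_k; rewrite (nth_mktuple _ _ (Ordinal lt_k)).
set x := Ordinal lt_k; have := tagnat.rect x.
rewrite (tnth_nth 1%g) /= => ->.
move: (tagnat.sig1 x) (tagnat.sig2 x) => i [j /= lt_j].
have [ei|ei] : i = ord0 \/ i = ord_max.
- by case: i {lt_j} => [[|[|//]] ?]; [left|right]; apply: val_inj.
- by rewrite ei in lt_j *; rewrite big_pred0 // add0n nth_cat lt_j.
rewrite ei (big_pred1 ord0) => [|l]; last by rewrite /= ltnS leqn0.
by rewrite nth_cat ltnNge leq_addr addKn.
Qed.

Lemma tuple_act_flatten k (w : 'I_k -> seq G) (s : 'S_k) :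
  tuple_act (tuple_flatten (fun i => in_tuple (w i)))
    (block_perm (fun i => size (w i)) s)
  = tuple_flatten (fun i => in_tuple (w (s i))) :> seq G.
Proof.
apply: (@eq_from_nth _ 1%g) => [|i].
  by rewrite !size_tuple; exact/esym/(sum_block_perm (fun i => size (w i))).
rewrite size_tuple => lt_i; rewrite (nth_mktuple _ _ (Ordinal lt_i)).
have lt_i' : (i < \sum_j size (w (s j)))%N.
  by rewrite (sum_block_perm (fun j => size (w j))).
rewrite (nth_mktuple _ _ (Ordinal lt_i')) tnth_mktuple permE /block_perm_fun.
have -> : cast_ord (esym (sum_block_perm (fun i => size (w i)) s))
            (Ordinal lt_i) = Ordinal lt_i' by apply: val_inj.
move: (Ordinal lt_i') => y {i lt_i lt_i'}.
rewrite !(tnth_nth 1%g) /=.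
set j : 'I_(size (w (s (tagnat.sig1 y)))) := tagnat.sig2 y.
rewrite [X in nth _ _ X](congr1 val (tagnat.Rank2K j)) /=.
by rewrite tagnat.Rank1K.
Qed.

(** The block condition for two blocks shows that the factor only depends on
    h = word_prod v, and is the factor t of swapping the letters 1 and h.
    Moving the word 1 1 past v in one or in two steps gives t = t * t. *)
Lemma word_theta_swap u v : trivial_word u ->
  word_theta (u ++ v) (v ++ u) = 1.
Proof.
move=> /eqP u1.
wlog u_gt0 : / (0 < size u)%N.
  by case: (u) => [|a u'] H; [rewrite cats0 word_theta_refl | apply: H].
wlog v_gt0 : / (0 < size v)%N.
  by case: (v) => [|a u'] H; [rewrite cats0 word_theta_refl | apply: H].
pose h := word_prod v.
have swap12 (u' v' : seq G) : (0 < size u')%N -> (0 < size v')%N ->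
  word_prod u' = 1%g -> word_prod v' = h ->
  word_theta (u' ++ v') (v' ++ u') = theta [tuple 1%g; h] (tperm ord0 ord_max).
  move=> u'0 v'0 pu pv; pose w (i : 'I_2) := if i == ord0 then u' else v'.
  rewrite (@commfun_block _ _ _ theta_comm _ _ _ _
    (fun i => in_tuple (w i))) //.
  - rewrite -word_thetaE.
    + by rewrite tuple_act_flatten !tuple_flatten2 tpermL tpermR.
    + by rewrite big_ord_recl big_ord1 ltn_addr.
    + rewrite inE !tuple_prodE tuple_act_flatten !tuple_flatten2.
      by rewrite tpermL tpermR !word_prodE pu pv mul1g mulg1.
  - by move=> i; rewrite /w; case: ifP.
  - move=> i; rewrite tuple_prodE /= /w (tnth_nth 1%g).
    by case: i => [[|[|//]] ?] /=.
  - rewrite inE /tuple_prod !big_ord_recl !big_ord0 !tnth_mktuple.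
    have -> : lift ord0 ord0 = ord_max :> 'I_2 by apply: val_inj.
    by rewrite tpermL tpermR !(tnth_nth 1%g) /= mul1g !mulg1.
rewrite swap12 //; set t := theta _ _.
have p1 : word_prod [:: 1%g : G] = 1%g by rewrite !word_prodE mulg1.
have r1 : rearranged ([:: 1%g] ++ v) (v ++ [:: 1%g]).
  by apply: rearranged_swap; apply/eqP.
have t1 : word_theta ([:: 1%g] ++ v) (v ++ [:: 1%g]) = t by rewrite swap12.
have r2 := rearranged_context [:: 1%g] [::] r1.
have r3 := rearranged_context [::] [:: 1%g] r1.
have tt : t * t = t.
  rewrite -{1}t1 -(word_theta_context [:: 1%g] [::] r1).
  rewrite -{1}t1 -(word_theta_context [::] [:: 1%g] r1).
  rewrite !cats0 /= -catA in r2 r3 *; rewrite word_theta_trans //.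
  by apply: (swap12 [:: 1%g; 1%g]); rewrite // word_prod_cons p1 mulg1.
have t_neq0 : t != 0 by rewrite -t1 word_theta_neq0.
by apply: (mulfI t_neq0); rewrite mulr1.
Qed.

Lemma word_theta_commutation : is_word_commutation word_theta.
Proof.
split; [exact: word_theta_neq0 | exact: word_theta_trans |
        exact: word_theta_context | exact: word_theta_swap].
Qed.

End CommFun.

(** * Central characters *)

(** Words modulo rearrangement do not form a group, so closure under quotients
    stands for closure under inverses.  The last condition makes the quotient
    of the words of product 1 by S of exponent dividing |G|. *)
Record admissible (G : finGroupType) (S : pred (seq G)) : Prop := Admissible {
  adm_trivial : forall u, S u -> trivial_word u;
  adm_rearranged : forall u v, S u -> rearranged u v -> S v;
  adm_cat : forall u v, S u -> S v -> S (u ++ v);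
  adm_quot : forall u v, S u -> S (u ++ v) -> S v;
  adm_base : forall u, trivial_word u ->
    (forall g : G, #|G| %| count_mem g u)%N -> S u
}.

(** A retraction onto the scalars of the extension defined by Th, over the
    words of S. *)
Record is_central_char (F : fieldType) (G : finGroupType)
    (Th : seq G -> seq G -> F) (S : pred (seq G)) (c : seq G -> F) : Prop :=
  CentralChar {
  char_neq0 : forall u, S u -> c u != 0;
  char_cat : forall u v, S u -> S v -> c (u ++ v) = c u * c v;
  char_rearranged : forall u v, S u -> rearranged u v -> c u = Th u v * c v
}.

Section Admissible.
Variables (G : finGroupType) (S : pred (seq G)).
Hypothesis S_adm : admissible S.

Lemma adm_nil : S [::].
Proof. by apply: (adm_base S_adm); rewrite /trivial_word ?word_prodE. Qed.

Lemma adm_pow w n : S w -> S (word_pow w n).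
Proof.
by move=> Sw; elim: n => [|n IHn]; [exact: adm_nil | exact: adm_cat].
Qed.

Lemma adm_pow_card w k : trivial_word w -> S (word_pow w (k * #|G|)).
Proof.
move=> w1; apply: (adm_base S_adm); first exact: trivial_word_pow.
by move=> g; rewrite count_word_pow mulnAC dvdn_mull.
Qed.

(** Multiplying a word g h w of product 1 by (gh)^-1 (gh) gives a rearrangement
    of (gh)^-1 g h followed by the shorter word (gh) w. *)
Lemma adm_generated :
  (forall g h : G, S [:: (g * h)^-1; g; h]%g) ->
  (forall g : G, S [:: g^-1; g]%g) -> forall w, trivial_word w -> S w.
Proof.
move=> S3 S2 w; have [n] := ubnP (size w).
elim: n w => // n IHn [|g [|h w]] lt_n; first by rewrite adm_nil.
  rewrite /trivial_word !word_prodE mulg1 => /eqP->.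
  apply: (adm_quot S_adm (S2 1%g)); have := S3 1%g 1%g.
  by rewrite mulg1 invg1.
move=> w1; apply: (adm_quot S_adm (S2 (g * h)%g)).
have w1' : trivial_word ((g * h)%g :: w).
  by move: w1; rewrite /trivial_word !word_prodE mulgA.
have Sw := IHn ((g * h)%g :: w) lt_n w1'.
apply: (adm_rearranged S_adm (adm_cat S_adm (S3 g h) Sw)).
apply/andP; split; last by rewrite !word_prodE !mulg1 !mulgA eqxx.
rewrite /= perm_cons (perm_catCA [:: g; h] [:: (g * h)%g] w).
exact: perm_refl.
Qed.

End Admissible.

Section Characters.
Variables (F : fieldType) (G : finGroupType).
Variable Th : seq G -> seq G -> F.
Hypothesis Th_comm : is_word_commutation Th.
Implicit Types (u v w x y : seq G) (g h : G) (S : pred (seq G)).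

Lemma wordcomm_refl u : Th u u = 1.
Proof.
have uu := rearranged_refl u.
apply: (mulfI (wordcomm_neq0 Th_comm uu)); rewrite mulr1.
exact: (wordcomm_trans Th_comm).
Qed.

Lemma wordcomm_swap_context x u v y : trivial_word u ->
  Th (x ++ u ++ v ++ y) (x ++ v ++ u ++ y) = 1.
Proof.
move=> u1; rewrite (catA u) (catA v) (wordcomm_context Th_comm).
  exact: (wordcomm_swap Th_comm).
exact: rearranged_swap.
Qed.

Lemma char_swap S c x u v y : is_central_char Th S c ->
  trivial_word u -> S (x ++ u ++ v ++ y) ->
  c (x ++ u ++ v ++ y) = c (x ++ v ++ u ++ y).
Proof.
move=> cP u1 Sw.
rewrite (char_rearranged cP Sw (rearranged_swap_context x v y u1)).
by rewrite wordcomm_swap_context ?mul1r.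
Qed.

Lemma char_nil S c : admissible S -> is_central_char Th S c -> c [::] = 1.
Proof.
move=> S_adm cP; have S0 := adm_nil S_adm.
by apply: (mulfI (char_neq0 cP S0)); rewrite mulr1 -(char_cat cP).
Qed.

Lemma char_pow S c w n : admissible S -> is_central_char Th S c -> S w ->
  c (word_pow w n) = c w ^+ n.
Proof.
move=> S_adm cP Sw; elim: n => [|n IHn]; first exact: (char_nil S_adm).
by rewrite word_powS (char_cat cP) ?adm_pow // IHn exprS.
Qed.

Definition base_word w := trivial_word w && [forall g, #|G| %| count_mem g w]%N.

Lemma base_admissible : admissible base_word.
Proof.
split=> [u /andP[]//|u v /andP[u1 /forallP Gu] uv|u v|u v|u u1 Gu].
- rewrite /base_word (rearranged_trivial uv) //=; apply/forallP => g.
  by case/andP: uv => /seq.permP <- _.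
- case/andP=> u1 /forallP Gu /andP[v1 /forallP Gv].
  rewrite /base_word trivial_word_cat //=; apply/forallP=> g.
  by rewrite count_cat dvdn_add.
- case/andP=> u1 /forallP Gu /andP[v1 /forallP Gv].
  move: v1; rewrite /base_word /trivial_word word_prodE (eqP u1) mul1g => -> /=.
  by apply/forallP=> g; have := Gv g; rewrite count_cat dvdn_addr.
- by rewrite /base_word u1; apply/forallP.
Qed.

(** The list s of letters is a parameter only for the sake of inductions; it
    is meant to be an enumeration of G. *)
Definition letter_sort (s : seq G) w :=
  flatten [seq nseq (count_mem g w) g | g <- s].

Lemma perm_letter_sort w : perm_eq w (letter_sort (enum G) w).
Proof.
apply/allP => g _ /=; rewrite count_flatten -map_comp sumnE big_map big_enum /=.
rewrite (bigD1 g) //= count_nseq /= eqxx mul1n big1 ?addn0 // => h /negPf.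
by rewrite count_nseq /= => ->.
Qed.

Lemma word_prod_nseq g n : word_prod (nseq n g) = (g ^+ n)%g.
Proof. by elim: n => [|n IHn]; rewrite /= !word_prodE // IHn expgS. Qed.

Lemma trivial_nseq g n : (#|G| %| n)%N -> trivial_word (nseq n g).
Proof.
move=> Gn; rewrite /trivial_word word_prod_nseq -order_dvdn.
by rewrite (dvdn_trans _ Gn) // -cardsT order_dvdG ?inE.
Qed.

Lemma trivial_letter_sort s w :
  (forall g, #|G| %| count_mem g w)%N -> trivial_word (letter_sort s w).
Proof.
move=> Gw; elim: s => [|g s IHs]; first by rewrite /trivial_word word_prodE.
by rewrite trivial_word_cat ?trivial_nseq.
Qed.

(** Merging two sorted words moves only blocks of equal letters past each
    other, and these blocks have product 1. *)
Lemma letter_sort_cat s u v :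
    (forall g, #|G| %| count_mem g u)%N ->
    (forall g, #|G| %| count_mem g v)%N ->
  rearranged (letter_sort s u ++ letter_sort s v) (letter_sort s (u ++ v)) /\
  Th (letter_sort s u ++ letter_sort s v) (letter_sort s (u ++ v)) = 1.
Proof.
move=> Gu Gv; elim: s => [|g s [IHr IHs]].
  by rewrite /= wordcomm_refl rearranged_refl.
rewrite /letter_sort /= -/(letter_sort s u) -/(letter_sort s v).
rewrite -/(letter_sort s (u ++ v)) count_cat nseqD -!catA.
set A := nseq _ g; set B := nseq _ g; set U := letter_sort s u in IHr IHs *.
set V := letter_sort s v in IHr IHs *; set UV := letter_sort s _ in IHr IHs *.
have U1 : trivial_word U by apply: trivial_letter_sort.
have r1 := rearranged_swap_context A B V U1.
have r2 := rearranged_context (A ++ B) [::] IHr.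
rewrite !cats0 -!catA in r2; split.
  exact: rearranged_trans r1 r2.
rewrite -(wordcomm_trans Th_comm r1 r2) wordcomm_swap_context // mul1r.
have := wordcomm_context Th_comm (A ++ B) [::] IHr.
by rewrite !cats0 -!catA => ->.
Qed.

Lemma base_rearranged w : base_word w -> rearranged w (letter_sort (enum G) w).
Proof.
case/andP=> /eqP w1 /forallP Gw; rewrite /rearranged perm_letter_sort w1 eq_sym.
exact: trivial_letter_sort.
Qed.

Lemma base_char :
  is_central_char Th base_word (fun w => Th w (letter_sort (enum G) w)).
Proof.
split=> [u /base_rearranged|u v Su Sv|u v Su uv].
- exact: (wordcomm_neq0 Th_comm).
- have ru := base_rearranged Su; have rv := base_rearranged Sv.
  have [/andP[u1 /forallP Gu] /andP[v1 /forallP Gv]] := (Su, Sv).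
  have [r e] := letter_sort_cat (enum G) Gu Gv.
  set U := letter_sort _ u in ru r e *; set V := letter_sort _ v in rv r e *.
  have r1 : rearranged (u ++ v) (U ++ v).
    exact: (rearranged_context [::] v ru).
  have r2 : rearranged (U ++ v) (U ++ V).
    by have := rearranged_context U [::] rv; rewrite !cats0.
  rewrite -(wordcomm_trans Th_comm (rearranged_trans r1 r2) r) e mulr1.
  rewrite -(wordcomm_trans Th_comm r1 r2) (wordcomm_context Th_comm [::] v ru).
  by have := wordcomm_context Th_comm U [::] rv; rewrite !cats0 => ->.
- have e : letter_sort (enum G) u = letter_sort (enum G) v.
    by congr flatten; apply: eq_map => g; case/andP: uv => /seq.permP->.
  have Sv := adm_rearranged base_admissible Su uv.
  by rewrite e (wordcomm_trans Th_comm uv (base_rearranged Sv)).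
Qed.

End Characters.

Section Existence.
Variables (F : closedFieldType) (G : finGroupType).
Variable Th : seq G -> seq G -> F.
Hypothesis Th_comm : is_word_commutation Th.

Lemma exists_root (a : F) n : (0 < n)%N -> exists r, r ^+ n = a.
Proof.
case: n => // n _.
have [r] := solve_monicpoly (fun i => if i == 0%N then a else 0) (ltn0Sn n).
rewrite big_ord_recl big1 /= => [|i _]; last by rewrite mul0r.
by rewrite expr0 mulr1 addr0; exists r.
Qed.

(** * Extension of central characters *)

Section Adjoin.
Variables (S : pred (seq G)) (c : seq G -> F) (w0 : seq G).
Hypotheses (S_adm : admissible S) (cP : is_central_char Th S c).
Hypothesis w0_trivial : trivial_word w0.

Local Notation pow := (word_pow w0).

Let G_gt0 : (0 < #|G|)%N.
Proof. by apply/card_gt0P; exists 1%g. Qed.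

Let pow_trivial n : trivial_word (pow n).
Proof. exact: trivial_word_pow. Qed.

(** The words of the group generated by S and w0.  As w0 to the power |G| lies
    in S, nonnegative powers below |G| suffice, which makes membership
    decidable. *)
Definition adjoin w := has (fun j => S (w ++ pow j)) (iota 0 #|G|).

Lemma adjoinP w : reflect (exists j, S (w ++ pow j)) (adjoin w).
Proof.
apply: (iffP hasP) => [[j _]|[j Sj]]; first by exists j.
exists (j %% #|G|)%N; first by rewrite mem_iota ltn_pmod.
apply: (adm_quot S_adm (adm_pow_card S_adm (j %/ #|G|) w0_trivial)).
apply: (adm_rearranged S_adm Sj); rewrite {1}(divn_eq j #|G|) word_powD.
have := rearranged_swap_context [::] w (pow (j %% #|G|))
          (pow_trivial (j %/ #|G| * #|G|)).
by rewrite /rearranged perm_sym eq_sym.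
Qed.

(** With e minimal such that the e-th power of w0 lies in S, any e-th root of
    the value of c there works: by closure under quotients, the exponents of
    the powers of w0 lying in S are the multiples of e. *)
Lemma adjoin_root :
  exists2 r, r != 0 & forall j, S (pow j) -> c (pow j) = r ^+ j.
Proof.
have exP : exists n, (0 < n)%N && S (pow n).
  by exists #|G|; rewrite -{2}[#|G|]mul1n adm_pow_card // G_gt0.
case: (ex_minnP exP) => e /andP[e_gt0 Se] e_min.
have [r rE] := exists_root (c (pow e)) e_gt0.
exists r.
  apply/eqP => r0; have /negP[] := char_neq0 cP Se.
  by rewrite -rE r0 expr0n gtn_eqF.
have powM n : pow (n * e) = word_pow (pow e) n.
  by elim: n => // n IHn; rewrite mulSn word_powD IHn.
move=> j Sj; have Sq n : S (pow (n * e)) by rewrite powM adm_pow.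
have Sr : S (pow (j %% e)).
  by apply: (adm_quot S_adm (Sq (j %/ e)%N)); rewrite -word_powD -divn_eq.
have r0 : (j %% e = 0)%N.
  apply: contraTeq (ltn_pmod j e_gt0); rewrite -lt0n -leqNgt => r_gt0.
  by apply: e_min; rewrite r_gt0.
rewrite (divn_eq j e) r0 addn0 powM (char_pow _ S_adm cP Se) -rE.
by rewrite -exprM mulnC.
Qed.

Lemma adjoin_indep r w i j : r != 0 ->
    (forall j, S (pow j) -> c (pow j) = r ^+ j) ->
    S (w ++ pow i) -> S (w ++ pow j) ->
  c (w ++ pow i) / r ^+ i = c (w ++ pow j) / r ^+ j.
Proof.
move=> r_neq0 rP; wlog le_ij : i j / (i <= j)%N => [IH Si Sj|].
  have [le_ij|/ltnW le_ji] := leqP i j; first exact: IH.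
  by apply: esym; apply: IH.
move=> Si; rewrite -(subnKC le_ij) word_powD catA => Sj.
have Sij := adm_quot S_adm Si Sj.
rewrite (char_cat cP Si Sij) rP // exprD invfM.
by rewrite mulrACA divff ?mulr1 // expf_neq0.
Qed.

Let swap_pow u i v j :
  rearranged (u ++ pow i ++ v ++ pow j) (u ++ v ++ pow (i + j)).
Proof. by rewrite word_powD; apply: rearranged_swap_context. Qed.

Lemma adjoin_admissible : admissible adjoin.
Proof.
split=> [u /adjoinP[j /(adm_trivial S_adm)]|u v /adjoinP[j Sj] uv|u v|u v
        |u u1 Gu].
- by rewrite /trivial_word word_prodE (eqP (pow_trivial j)) mulg1.
- apply/adjoinP; exists j; apply: (adm_rearranged S_adm Sj).
  exact: (rearranged_context [::] (pow j) uv).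
- case/adjoinP=> i Si /adjoinP[j Sj]; apply/adjoinP; exists (i + j)%N.
  have := adm_cat S_adm Si Sj; rewrite -!catA => /(adm_rearranged S_adm).
  exact.
- case/adjoinP=> i Si /adjoinP[j Sj]; apply/adjoinP.
  (* The power i * (|G| - 1) of w0 plays the role of the power - i. *)
  exists (j + i * #|G|.-1)%N; apply: (adm_quot S_adm Si).
  have := adm_cat S_adm Sj (adm_pow_card S_adm i w0_trivial).
  rewrite -!catA => Sw; apply: (adm_rearranged S_adm Sw).
  have := swap_pow u i v (j + i * #|G|.-1).
  rewrite /rearranged perm_sym eq_sym -word_powD.
  by have -> : (i + (j + i * #|G|.-1) = j + i * #|G|)%N by nia.
- by apply/adjoinP; exists 0%N; rewrite cats0; apply: (adm_base S_adm).
Qed.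

Lemma adjoin_sub u : S u -> adjoin u.
Proof. by move=> Su; apply/adjoinP; exists 0%N; rewrite cats0. Qed.

Lemma adjoin_mem : adjoin w0.
Proof.
apply/adjoinP; exists #|G|.-1; rewrite -word_powS prednK //.
by have := adm_pow_card S_adm 1 w0_trivial; rewrite mul1n.
Qed.

(** The value at w is c(w w0^j) / r^j for any j with w w0^j in S. *)
Lemma adjoin_char : exists c', is_central_char Th adjoin c'.
Proof.
have [r r_neq0 rP] := adjoin_root.
pose J w :=
  nth 0%N (iota 0 #|G|) (find (fun j => S (w ++ pow j)) (iota 0 #|G|)).
pose c' w := c (w ++ pow (J w)) / r ^+ J w.
have c'E w j : S (w ++ pow j) -> c' w = c (w ++ pow j) / r ^+ j.
  move=> Sj; have /(nth_find 0%N) SJ : adjoin w by apply/adjoinP; exists j.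
  exact: adjoin_indep.
exists c'; split=> [u /adjoinP[i Si]|u v /adjoinP[i Si] /adjoinP[j Sj]|].
- by rewrite (c'E _ _ Si) mulf_neq0 ?invr_eq0 ?expf_neq0 // (char_neq0 cP).
- have := adm_cat S_adm Si Sj; rewrite -!catA => Sij.
  have Suv := adm_rearranged S_adm Sij (swap_pow u i v j).
  rewrite (c'E _ _ Si) (c'E _ _ Sj) (c'E (u ++ v) (i + j)%N) -?catA //.
  rewrite mulrACA -invfM -exprD -(char_cat cP) // -!catA word_powD.
  by rewrite (char_swap Th_comm cP (pow_trivial i)).
- move=> u v /adjoinP[i Si] uv.
  have uvi := rearranged_context [::] (pow i) uv.
  rewrite (c'E _ _ Si) (c'E v i) ?(adm_rearranged S_adm Si) //.
  rewrite (char_rearranged cP Si uvi) (wordcomm_context Th_comm [::]) //.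
  by rewrite mulrA.
Qed.

End Adjoin.

Lemma char_adjoin_all (ws : seq (seq G)) S c :
    admissible S -> is_central_char Th S c -> all (@trivial_word G) ws ->
  exists S' c',
    [/\ admissible S', is_central_char Th S' c', subpred S S' & all S' ws].
Proof.
elim: ws S c => [|w ws IHws] S c S_adm cP; first by exists S, c; split.
case/andP=> w1 ws1; have [c1 c1P] := adjoin_char S_adm cP w1.
have [S' [c' [S'_adm c'P sSS' S'ws]]] :=
  IHws _ _ (adjoin_admissible S_adm w1) c1P ws1.
exists S', c'; split=> //= [u Su|]; first exact/sSS'/adjoin_sub.
by rewrite S'ws sSS' ?adjoin_mem.
Qed.

Lemma exists_char : exists c, is_central_char Th (@trivial_word G) c.
Proof.
pose w3 (p : G * G) := [:: (p.1 * p.2)^-1; p.1; p.2]%g.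
pose w2 (g : G) := [:: g^-1; g]%g.
have ws1 : all (@trivial_word G) (codom w3 ++ codom w2).
  rewrite all_cat; apply/andP; split; apply/allP=> _ /codomP[p ->].
    by rewrite /trivial_word !word_prodE mulg1 mulVg.
  by rewrite /trivial_word !word_prodE mulg1 mulVg.
have [S [c [S_adm cP _]]] :=
  char_adjoin_all (base_admissible G) (base_char Th_comm) ws1.
rewrite all_cat => /andP[/allP S3 /allP S2].
have ST : forall w, trivial_word w -> S w.
  apply: adm_generated => // [g h|g]; last by apply/S2/codom_f.
  exact: (S3 _ (codom_f w3 (g, h))).
by exists c; split=> [u /ST|u v /ST Su /ST Sv|u v /ST Su];
  [apply: (char_neq0 cP) | apply: (char_cat cP) | apply: (char_rearranged cP)].
Qed.

End Existence.

(** * The cocycle of a central character *)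

Section TwistedAlgebra.
Variables (F : fieldType) (G : finGroupType).
Variables (Th : seq G -> seq G -> F) (c : seq G -> F).
Hypothesis Th_comm : is_word_commutation Th.
Hypothesis cP : is_central_char Th (@trivial_word G) c.
Implicit Types (u v w x y : seq G) (g h k : G).

Lemma char_extract x u y : trivial_word u -> trivial_word (x ++ y) ->
  c (x ++ u ++ y) = c u * c (x ++ y).
Proof.
move=> u1 xy1; have uxy1 := trivial_word_cat u1 xy1.
by rewrite -(char_cat cP) // -(char_swap Th_comm (x := [::]) cP u1 uxy1).
Qed.

Lemma char_rotate x y : trivial_word (x ++ y) -> c (x ++ y) = c (y ++ x).
Proof.
move=> xy1; have yx1 : trivial_word (y ++ x).
  move: xy1; rewrite /trivial_word !word_prodE -!eq_invg_mul eq_invg_sym.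
  by rewrite eq_sym.
apply: (mulIf (char_neq0 cP xy1)).
rewrite -(char_extract yx1 xy1) -(char_cat cP xy1 xy1).
by rewrite -!catA.
Qed.

Definition word_coef w : F :=
  c ((word_prod w)^-1%g :: w) / c [:: (word_prod w)^-1; word_prod w]%g.

Lemma trivial_pair g : trivial_word [:: g^-1; g]%g.
Proof. by rewrite /trivial_word !word_prodE mulg1 mulVg. Qed.

Lemma trivial_closing w : trivial_word ((word_prod w)^-1%g :: w).
Proof. by rewrite /trivial_word word_prodE mulVg. Qed.

Lemma word_coef1 g : word_coef [:: g] = 1.
Proof.
rewrite /word_coef !word_prodE mulg1 divff //.
exact: (char_neq0 cP (trivial_pair g)).
Qed.

Lemma word_coef_neq0 w : word_coef w != 0.
Proof.
by rewrite mulf_neq0 ?invr_eq0 ?(char_neq0 cP) ?trivial_pair ?trivial_closing.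
Qed.

(** Up to the factors c(g^-1 g) this compares the words (k g h)(g^-1 u)(h^-1 v)
    and k u v, for k = (gh)^-1.  Inserting the words of product 1 into k g h
    after g and after h gives k (g g^-1) u (h h^-1) v. *)
Lemma word_coef_cat u v :
  word_coef (u ++ v) =
  word_coef u * word_coef v * word_coef [:: word_prod u; word_prod v].
Proof.
rewrite /word_coef !word_prodE mulg1.
have := trivial_closing v; have := trivial_closing u.
have := trivial_closing (u ++ v).
have := trivial_closing [:: word_prod u; word_prod v].
rewrite !word_prodE mulg1; set g := word_prod u; set h := word_prod v.
set k := (g * h)^-1%g => kgh1 kuv1 u1 v1.
have pair1 (a : G) : trivial_word [:: a; a^-1]%g.
  by rewrite -{1}[a]invgK trivial_pair.
have pairC (a : G) : c [:: a; a^-1]%g = c [:: a^-1; a]%g.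
  exact: (char_rotate (x := [:: a]) (pair1 a)).
have: c [:: k; g; h] * c (g^-1 :: u)%g * c (h^-1 :: v)%g =
      c [:: g^-1; g]%g * c [:: h^-1; h]%g * c (k :: u ++ v).
  have kghv1 := trivial_word_cat kgh1 v1.
  rewrite -!pairC -mulrA mulrCA -(char_cat cP kgh1 v1).
  rewrite -(char_extract (x := [:: k; g]) (y := h :: h^-1%g :: v)) //=.
  have kuhv1 : trivial_word ([:: k] ++ (u ++ [:: h; h^-1]%g ++ v)).
    by move: kuv1; rewrite /trivial_word !word_prodE !mulg1 mulgV mul1g.
  have := char_extract (pair1 g) kuhv1; rewrite /= => ->.
  have := char_extract (x := k :: u) (pair1 h) kuv1; rewrite /= => ->.
  by rewrite mulrA.
move=> e; have [gn hn kn] : [/\ c [:: g^-1; g]%g != 0, c [:: h^-1; h]%g != 0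
    & c [:: k; (g * h)%g] != 0].
  by split; apply: (char_neq0 cP); apply: trivial_pair.
(* Clear denominators. *)
apply: (mulIf (mulf_neq0 (mulf_neq0 gn hn) kn)).
transitivity (c [:: g^-1; g]%g * c [:: h^-1; h]%g * c (k :: u ++ v)).
  by field.
by rewrite -e; field; rewrite kn hn.
Qed.

Definition coef_cocycle_fun g h := word_coef [:: g; h].

Lemma coef_cocycleP g h k :
  coef_cocycle_fun g h * coef_cocycle_fun (g * h)%g k =
  coef_cocycle_fun h k * coef_cocycle_fun g (h * k)%g.
Proof.
have := word_coef_cat [:: g; h] [:: k]; have := word_coef_cat [:: g] [:: h; k].
by rewrite /= !word_coef1 !word_prodE !mulg1 mulr1 mul1r => -> <-.
Qed.

Definition coef_cocycle : cocycle2 F G :=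
  Cocycle2 (fun g h => word_coef_neq0 [:: g; h]) coef_cocycleP.

Lemma prod_tga_basis w :
  \prod_(x <- w) tga_basis coef_cocycle x =
  word_coef w *: tga_basis coef_cocycle (word_prod w).
Proof.
elim: w => [|g w IHw].
  rewrite big_nil word_prodE; congr (_ *: _).
  apply: (mulIf (word_coef_neq0 [:: 1; 1]%g)); rewrite mulVf ?word_coef_neq0 //.
  have := word_coef_cat [::] [::]; rewrite word_prodE /=.
  by move=> e; apply: (mulfI (word_coef_neq0 [::])); rewrite mulr1 mulrA.
rewrite big_cons IHw word_prodE.
rewrite -[_ * _]/(tga_mul _ _) -tga_scalerAr tga_mulUU scalerA; congr (_ *: _).
have := word_coef_cat [:: g] w; rewrite /= word_coef1 mul1r => ->.
by rewrite !word_prodE mulg1.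
Qed.

Lemma word_coef_rearranged u v : rearranged u v ->
  word_coef u = Th u v * word_coef v.
Proof.
move=> uv; have := rearranged_context [:: (word_prod u)^-1%g] [::] uv.
rewrite /word_coef !cats0 => uv'.
rewrite (char_rearranged cP (trivial_closing u) uv').
have := wordcomm_context Th_comm [:: (word_prod u)^-1%g] [::] uv.
by rewrite !cats0 => ->; case/andP: uv => _ /eqP <-; rewrite mulrA.
Qed.

End TwistedAlgebra.

Theorem lemma32 (F : closedFieldType) (charF0 : [pchar F] =i pred0)
    (G : finGroupType) (theta : forall n, n.-tuple G -> 'S_n -> F)
    (theta_comm : is_commutation_fun theta)
    (theta_diag : forall g : G, commfun2 theta g g = 1) :
  exists alpha : cocycle2 F G, is_tga_commutation_fun alpha theta.
Proof.
have Th_comm := word_theta_commutation theta_comm theta_diag.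
have [c cP] := exists_char Th_comm.
set alpha := coef_cocycle Th_comm cP; exists alpha => n g s n_gt0 sS.
have prodE (t : n.-tuple G) : \prod_(i < n) tga_basis alpha (tnth t i)
    = word_coef c t *: tga_basis alpha (word_prod t).
  by rewrite -prod_tga_basis big_tuple.
have gs := rearranged_tuple_act sS.
have -> : \prod_(i < n) tga_basis alpha (tnth g (s i)) =
    \prod_(i < n) tga_basis alpha (tnth (tuple_act g s) i).
  by apply: eq_bigr => i _; rewrite tnth_mktuple.
rewrite !prodE scalerA -(word_thetaE theta_comm theta_diag n_gt0 sS).
rewrite -(word_coef_rearranged Th_comm cP gs).
by case/andP: gs => _ /eqP ->.
Qed.
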